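(* Let $q$ be a prime power, $n\geq 3$ and $1\leq k<\frac{n}{2}$ integers, and assume that $q\geq 17$ if $k=1$ and $q\geq 13$ if $k\geq 2$. Let $\mathcal{H}(n,n-k,q)$ be the hypergraph whose vertices are the points of $\mathrm{PG}(n,q)$ and whose hyperedges are the $(n-k)$-dimensional subspaces of $\mathrm{PG}(n,q)$. Then \[\bar\chi(\mathcal{H}(n,n-k,q))=\theta_n-\tau_2(\mathcal{H}(n,n-k,q))+1=\theta_n-2\theta_k+1.\]
   Context: For a hypergraph $\mathcal{H}=(V;E)$, a strict $N$-coloring is a partition of $V$ into exactly $N$ nonempty color classes. A hyperedge is rainbow if no two of its vertices have the same color. The upper chromatic number $\bar\chi(\mathcal{H})$ is the largest $N$ such that $\mathcal{H}$ admits a strict $N$-coloring with no rainbow hyperedge. A $t$-transversal is a vertex set $T$ with $|T\cap H|\geq t$ for every hyperedge $H$, and $\tau_t(\mathcal{H})$ is the minimum size of a $t$-transversal. Dimensions are projective, and $\theta_m=\frac{q^{m+1}-1}{q-1}=q^m+\dots+q+1$ is the number of points of an $m$-dimensional projective space of order $q$. *)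

(* Defs.v *)
From HB Require Import structures.
From mathcomp Require Import all_boot all_order all_algebra.

Set Implicit Arguments.
Unset Strict Implicit.
Unset Printing Implicit Defensive.

Import Order.TTheory GRing.Theory Num.Theory.

Record hypergraph := Hypergraph {
  vertex : finType;
  edges : {set {set vertex}}
}.

(* A colouring is the partition of the vertex set into its colour classes;
   [partition] already requires the classes to be nonempty. *)
Definition strict_coloring (H : hypergraph) (N : nat)
    (C : {set {set vertex H}}) : bool :=
  partition C [set: vertex H] && (#|C| == N).

Definition rainbow (V : finType) (C : {set {set V}}) (e : {set V}) : bool :=
  [forall x in e, forall y in e, (x != y) ==> (pblock C x != pblock C y)].

Definition rainbow_free (H : hypergraph) (C : {set {set vertex H}}) : bool :=
  [forall e in edges H, ~~ rainbow C e].

Definition colorable (H : hypergraph) (N : nat) : bool :=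
  [exists C : {set {set vertex H}}, strict_coloring N C && rainbow_free C].

(* A strict N-colouring has N <= #|vertex H|, so the bound on N loses nothing.
   The value is 0 when no rainbow-free colouring exists. *)
Definition upper_chromatic (H : hypergraph) : nat :=
  \max_(N < #|vertex H|.+1 | colorable H N) N.

Definition t_transversal (H : hypergraph) (t : nat) (T : {set vertex H}) : bool :=
  [forall e in edges H, t <= #|T :&: e|].

(* The value is #|vertex H| when there is no t-transversal. *)
Definition tau (t : nat) (H : hypergraph) : nat :=
  #|[arg min_(T < [set: vertex H] | t_transversal t T) #|T|]|.

Lemma strict_coloring_le (H : hypergraph) (N : nat) (C : {set {set vertex H}}) :
  strict_coloring N C -> N <= #|vertex H|.
Proof.
case/andP=> partC /eqP <-.
have C0 : set0 \notin C by case/and3P: partC.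
rewrite -cardsT (card_partition partC) -sum1_card leq_sum // => B BC.
by rewrite card_gt0; apply: contraNneq C0 => <-.
Qed.

Lemma upper_chromaticP (H : hypergraph) (N : nat) :
    (exists M, colorable H M) ->
  upper_chromatic H = N <->
  colorable H N /\ (forall M, colorable H M -> M <= N).
Proof.
have lt_card M : colorable H M -> M < #|vertex H|.+1.
  by case/existsP=> C /andP[/strict_coloring_le].
have ub M : colorable H M -> M <= upper_chromatic H.
  move=> colM; rewrite /upper_chromatic.
  exact: (@leq_bigmax_cond _ (fun i : 'I__ => colorable H i)
            (fun i : 'I__ => nat_of_ord i) (Ordinal (lt_card M colM))).
case=> M0 colM0.
have colmax : colorable H (upper_chromatic H).
  rewrite /upper_chromatic.
  rewrite (bigop.bigmax_eq_arg (Ordinal (lt_card M0 colM0))) //.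
  by case: arg_maxnP.
split=> [<-|[colN maxN]]; first by [].
by apply/eqP; rewrite eqn_leq maxN //= ub.
Qed.

Lemma tauP (t : nat) (H : hypergraph) (m : nat) :
    (exists T : {set vertex H}, t_transversal t T) ->
  tau t H = m <->
  (exists2 T : {set vertex H}, t_transversal t T & #|T| = m) /\
  (forall T : {set vertex H}, t_transversal t T -> m <= #|T|).
Proof.
case=> T0 trT0.
have trT : t_transversal t [set: vertex H].
  apply/forall_inP => e eH; rewrite setTI.
  exact: leq_trans (forall_inP trT0 e eH) (subset_leq_card (subsetIr _ _)).
rewrite /tau; case: arg_minnP => // T1 tr1 min1.
split=> [<-|[[T trT2 <-] minT]]; first by split; first exists T1.
by apply/eqP; rewrite eqn_leq min1 //= minT.
Qed.

(* Gives access to the subtype structure of {vspace vT} over canonical matrices. *)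
Import VectorInternalTheory.

HB.instance Definition _ (F : finFieldType) (vT : vectType F) :=
  [Countable of {vspace vT} by <:].
HB.instance Definition _ (F : finFieldType) (vT : vectType F) :=
  [Finite of {vspace vT} by <:].

(* PG(n, q) consists of the subspaces of F^(n+1) with #|F| = q; a subspace of
   projective dimension d has vector-space dimension d+1. *)
Definition pg_point (F : finFieldType) (n : nat) : finType :=
  {U : {vspace 'rV[F]_n.+1} | \dim U == 1}.

Definition pg_points_of (F : finFieldType) (n : nat)
    (W : {vspace 'rV[F]_n.+1}) : {set pg_point F n} :=
  [set P | (val P <= W)%VS].

Definition pg_hypergraph (F : finFieldType) (n d : nat) : hypergraph :=
  @Hypergraph (pg_point F n)
    [set pg_points_of W | W : {vspace 'rV[F]_n.+1} & \dim W == d.+1].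

Definition theta (q m : nat) : nat := \sum_(i < m.+1) q ^ i.

(* Main.v *)
(* Codimension-k subspaces are handled as kernels of matrices M with k columns
   (the kernel may be larger, which only helps). Over a uniformly random M, a
   point lies in ker M with probability q^-k and two distinct points with
   probability exactly q^-2k, so the number of points of a class in ker M has
   known first and second moments.

   Suppose a rainbow-free colouring has sum (|B| - 1) <= 2 theta_k - 2 over its
   classes B, and let A be the largest class. Project from a random
   codimension-(k+1) subspace S avoiding all non-singleton classes: each of the
   theta_k subspaces of codimension k through S contains two points of A or a
   monochromatic pair of another class. If the other classes were all small,
   some S would yield so few such pairs that A would be too large; hence a
   second class B also has size about q^k.

   With X = |A n ker M| and Y = |B n ker M|, the quadratic 3(X + Y) + (X - Y)^2
   - 10 is nonnegative whenever X >= 2 or Y >= 2, but its average is negative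
   when |A| and |B| are about q^k, and the remaining classes are too small to
   compensate.

   The lower bound on tau_2 follows by giving a 2-transversal one colour and
   all other points distinct colours. *)
Require Import Defs.
From mathcomp Require Import all_boot all_order all_algebra all_field.
From mathcomp Require Import zify.

Import Order.TTheory GRing.Theory Num.Theory.
Local Open Scope ring_scope.

(** * Counting matrices that kill given vectors *)

(** [V] has a right inverse, so translating by a preimage of [Y] shows that all fibres of the map
    from [M] to [V *m M] have the same size. *)
Lemma sum_mulmx_eq0 {F : finFieldType} {r n : nat} m {V : 'M[F]_(r, n)} :
  row_free V ->
  ((\sum_(M : 'M[F]_(n, m)) nat_of_bool (V *m M == 0)%R) * #|F| ^ (r * m)
   = #|F| ^ (n * m))%N.
Proof.
move=> freeV; rewrite -!card_mx mulnC -sum_nat_const -[RHS]sum1_card.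
under [RHS]eq_bigr => M _.
  rewrite (_ : 1%N = \sum_(Y : 'M[F]_(r, m)) nat_of_bool (V *m M == Y));
    first over.
  rewrite (bigD1 (V *m M)) //= eqxx big1 ?addn0 // => Y.
  by rewrite eq_sym => /negPf->.
rewrite [RHS]exchange_big /=; apply: eq_bigr => Y _.
rewrite (reindex_inj (addIr (- (pinvmx V *m Y)))) /=; apply: eq_bigr => M _.
by rewrite mulmxBr mulmxA mulmxVp // mul1mx subr_eq0.
Qed.

Lemma row_free_row {F : finFieldType} {n : nat} {u : 'rV[F]_n} :
  u != 0 -> row_free u.
Proof. by move=> u0; rewrite /row_free rank_rV u0. Qed.

Lemma sum_card_setI {T : finType} (A K : {set T}) :
  (\sum_(x in A) (x \in K) = #|A :&: K|)%N.
Proof.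
by rewrite -sum1_card -big_mkcondr /=; apply: eq_bigl => x; rewrite inE.
Qed.

Lemma sum_distinct_pairs {T : finType} (A K : {set T}) :
  (\sum_(x in A) \sum_(y in A | y != x) (x \in K) * (y \in K)
     = #|A :&: K| * #|A :&: K|.-1)%N.
Proof.
rewrite -sum_nat_const [LHS]big_mkcond [RHS]big_mkcond; apply: eq_bigr => x _.
rewrite inE; case: (boolP (x \in A)) => //= xA.
rewrite -big_distrr /=; case: (boolP (x \in K)) => //= xK.
rewrite mul1n (cardsD1 x (A :&: K)) inE xA xK /= -sum1_card.
rewrite [LHS]big_mkcond [RHS]big_mkcond.
apply: eq_bigr => y _; rewrite !inE.
by case: eqP; case: (y \in A); case: (y \in K).
Qed.

Lemma card_scalar_multiples {F : finFieldType} {n : nat} (w : 'rV[F]_n) :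
  w != 0 -> (\sum_(u : 'rV[F]_n | u != 0%R) (w <= u)%MS <= #|F|.-1)%N.
Proof.
move=> w0; rewrite -(cardC1 (0 : F)) -sum1_card.
rewrite [leqRHS](eq_bigr (fun c => \sum_(u : 'rV[F]_n) (u == c *: w)%R)%N);
  last first.
  by move=> c _; rewrite (bigD1 (c *: w)) //= eqxx big1 // => u /negPf->.
rewrite exchange_big /= [leqLHS]big_mkcond leq_sum // => u _.
case: ifP => // u0; case: (boolP (w <= u)%MS) => // /sub_rVP[c wE].
have c0 : c != 0 by apply: contraNneq w0 => c0; rewrite wE c0 scale0r.
rewrite (bigD1 c^-1) /=; last by rewrite inE invr_eq0.
by rewrite wE scalerA mulVf // scale1r eqxx.
Qed.

(** * Arithmetic of the two largest classes *)

(* [(x - y)^2 + 3 (x + y) - 10] is the quadratic that detects [x >= 2]. *)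
Lemma two_class_quadratic x y : (1 < x)%N || (1 < y)%N ->
  (10 + 2 * (x * y) <= 3 * (x + y) + (x * x + y * y))%N.
Proof.
move=> xy1; have [xy|xy] := leqP 4 (x + y).
  by have [+ _] := nat_Cauchy x y; rewrite -!mulnn; lia.
by move: x y xy1 xy => [|[|[|[|x]]]] [|[|[|[|y]]]] /=; lia.
Qed.

(** A third class with two points in the kernel has [e * e - e] at least 2, so the weight 5 pays for
    the constant 10, while 3(x + y) + (x - y)^2 stays nonnegative. *)
Lemma third_class_quadratic x y e s s' : (1 < e)%N -> (s <= s')%N ->
  (10 + 2 * (x * y) + 5 * (e + s) <= 3 * (x + y) + (x * x + y * y)
     + 5 * (e * e + s'))%N.
Proof.
move=> e1 les; have [+ _] := nat_Cauchy x y; rewrite -!mulnn.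
by have := leq_mul e1 (leqnn e); lia.
Qed.

(** [Z] is the number of matrices and each [S] a sum over them. Since X^2 has mean a/Q + a(a -
    1)/Q^2, the coefficient 3 of X becomes 4 once denominators are cleared. *)
Lemma average_arith Z Q a b d dd d1 SA SB SAB SAA SBB SD SDD : (0 < Z)%N ->
    (SA * Q = a * Z)%N -> (SB * Q = b * Z)%N -> (SAB * Q ^ 2 = a * b * Z)%N ->
    (SAA * Q ^ 2 + a * Z = a * Z * Q + a * a * Z)%N ->
    (SBB * Q ^ 2 + b * Z = b * Z * Q + b * b * Z)%N ->
    (SD * Q = d * Z)%N ->
    (SDD * Q ^ 2 + d * Z = d * Z * Q + dd * Z)%N -> (d1 + d = dd)%N ->
    (Q * Q * (Z * 10 + 2 * SAB + 5 * SD)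
       <= Q * Q * (3 * (SA + SB) + (SAA + SBB) + 5 * SDD))%N ->
  (10 * Q ^ 2 + 2 * (a * b) + a + b
     <= 4 * (a + b) * Q + a ^ 2 + b ^ 2 + 5 * d1)%N.
Proof.
move=> Z0 eA eB eAB eAA eBB eD eDD ed le_sum.
have {}eA := congr1 (muln Q) eA; have {}eB := congr1 (muln Q) eB.
have {}eD := congr1 (muln Q) eD; have {}ed := congr1 (muln Z) ed.
by rewrite -(leq_pmul2l Z0); move: eA eB eD eAB eAA eBB eDD ed le_sum; lia.
Qed.

(* Here [Q = q ^ k], [th = theta q k], [a] and [b] are the sizes of the two
   largest classes, [R] is the sum of the [|D| - 1] and [s] that of the
   [|D| (|D| - 1)] over the other classes, and [t] is the number of points in
   non-singleton classes. *)
Lemma no_two_big_classes {q Q th a b R s t : nat} :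
    (13 <= q)%N -> (q <= Q)%N -> ((q.-1 * th).+1 = q * Q)%N ->
    (b <= a)%N -> (a + b + R <= 2 * th)%N -> (t + 4 <= 4 * th)%N ->
    (q * Q <= q.-1 * b + t)%N -> (s <= R.+1 * R)%N ->
  ~ (10 * Q ^ 2 + 2 * (a * b) + a + b
       <= 4 * (a + b) * Q + a ^ 2 + b ^ 2 + 5 * s)%N.
Proof.
case: q => // q q13 qQ thE ba sum_le t_le Q_le s_le quad.
rewrite /= in thE Q_le.
(* [q] is now the order minus one, so it is at least 12 and [th] is below (1 + 1/q)Q. *)
have th_le : (12 * th <= 13 * Q)%N.
  have q12Q : (12 * Q <= q * Q)%N by rewrite leq_mul2r; lia.
  have : (q * (12 * th) <= q * (13 * Q))%N by lia.
  by rewrite leq_pmul2l //; lia.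
(* Eliminating [t] and [th] bounds b/Q below by (q + 1)(q - 4)/q^2, which increases with [q] and
   equals 13/18 at 12. *)
have b_ge : (13 * Q <= 18 * b)%N.
  have sq : (13 * q ^ 2 <= 18 * (q.+1 * (q - 4)))%N.
    have [x ->] : exists x, q = (x + 12)%N by exists (q - 12)%N; lia.
    have -> : (x + 12 - 4 = x + 8)%N by lia.
    by rewrite -mulnn; have := leq0n (x * x); lia.
  have lb : (q.+1 * (q - 4) * Q <= q ^ 2 * b)%N.
    have e1 : (q * (q.+1 * Q) <= q * (q * b + 4 * th))%N.
      by rewrite leq_mul2l; apply/orP; right; lia.
    have [x xE] : exists x, q = (x + 4)%N by exists (q - 4)%N; lia.
    have -> : (q - 4 = x)%N by lia.
    by move: e1 thE; rewrite -mulnn xE; lia.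
  have := leq_mul sq (leqnn Q).
  move: lb; rewrite -(leq_pmul2l (isT : 0 < 18)%N).
  move=> /[swap] l1; rewrite mulnA -!mulnA in l1 *.
  move=> l2; have : (q ^ 2 * (13 * Q) <= q ^ 2 * (18 * b))%N by lia.
  by rewrite leq_pmul2l // expn_gt0; lia.
have [e aE] : exists e, a = (b + e)%N by exists (a - b)%N; lia.
have [d dE] : exists d, (2 * th = 2 * b + d)%N.
  by exists (2 * th - 2 * b)%N; lia.
(* 2 * 13/12 - 2 * 13/18 = 13/18. *)
have d_le : (18 * d <= 13 * Q)%N by lia.
have eR : (e + R <= d)%N by lia.
have quad2 : (10 * (Q * Q) <= 4 * (2 * b + e) * Q + e * e + 5 * s)%N.
  by move: quad; rewrite aE -!mulnn; lia.
have be : (2 * b + e + R <= 2 * th)%N by lia.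
(* The right side of [quad2] is at most (26/3 + (13/18)^2 + 5/18)Q^2 < 10 Q^2: the leftover 4Rd is
   absorbed by -4RQ, and 5R is at most 5Q^2/18. *)
have m1 := leq_mul be (leqnn Q); have m2 := leq_mul th_le (leqnn Q).
have m3 : (e * e + R * d <= d * d)%N.
    have eed := leq_mul (leq_trans (leq_addr R e) eR) (leqnn e).
    by have := leq_mul (leqnn d) eR; lia.
have m4 : (R * R <= R * d)%N by rewrite leq_mul2l; lia.
have m5 := leq_mul (leqnn R) d_le; have m6 := leq_mul d_le d_le.
have m7 : (13 * Q <= Q * Q)%N by rewrite leq_mul2r; lia.
lia.
Qed.

(** * Moments of the number of points in a random kernel *)

Section Colouring.
Variables (F : finFieldType) (T : finType) (n : nat).
Variable v : T -> 'rV[F]_n.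

Definition kpts {l} (M : 'M[F]_(n, l)) : {set T} := [set P | v P *m M == 0].

Hypothesis freev : forall P, v P != 0.
Hypothesis freev2 : forall P P', P != P' -> row_free (col_mx (v P) (v P')).

Lemma row_free2_subZ (P P' : T) (c : F) : P != P' -> v P - c *: v P' != 0.
Proof.
move=> /freev2 /row_freeP[B]; rewrite mul_col_mx => defB.
apply: contra_neq (oner_neq0 F) => /eqP; rewrite subr_eq0 => /eqP vP.
have e (i j : 'I_(1 + 1)) := congr1 (fun A : 'M_(1 + 1) => A i j) defB.
have := e (rshift 1 0) (lshift 1 0); rewrite col_mxEd [1%:M _ _]mxE => vP'0.
have {e} := e (lshift 1 0) (lshift 1 0).
rewrite col_mxEu vP -scalemxAl [X in X = _ -> _]mxE vP'0 mulr0 mxE eqxx.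
exact: esym.
Qed.

Lemma sum_in_kpts m P :
  ((\sum_(M : 'M_(n, m)) (P \in kpts M)%R) * #|F| ^ m = #|F| ^ (n * m))%N.
Proof.
rewrite -(sum_mulmx_eq0 m (row_free_row (freev P))) mul1n.
by under eq_bigr do rewrite inE.
Qed.

Lemma sum_in_kpts2 m {P P'} : P != P' ->
  ((\sum_(M : 'M_(n, m)) (P \in kpts M) * (P' \in kpts M)) * #|F| ^ (2 * m)
     = #|F| ^ (n * m))%N.
Proof.
move=> /freev2 /(sum_mulmx_eq0 m) <-.
by under eq_bigr do rewrite !inE mulnb -col_mx_eq0 -mul_col_mx.
Qed.

Lemma sum_card_kpts m (A : {set T}) :
  ((\sum_(M : 'M_(n, m)) #|A :&: kpts M|) * #|F| ^ m
     = #|A| * #|F| ^ (n * m))%N.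
Proof.
under eq_bigr do rewrite -sum_card_setI.
rewrite exchange_big /= big_distrl /= -sum_nat_const.
by apply: eq_bigr => P _; rewrite sum_in_kpts.
Qed.

(** Distinct points lie in the kernel independently, but a point of [A :&: B] paired with itself has
    probability q^-m instead of q^-2m. The subtracted part of this correction stands on the left. *)
Lemma sum_card_kpts2 m (A B : {set T}) :
  ((\sum_(M : 'M_(n, m)) #|A :&: kpts M| * #|B :&: kpts M|) * #|F| ^ (2 * m)
     + #|A :&: B| * #|F| ^ (n * m)
   = #|A :&: B| * #|F| ^ (n * m) * #|F| ^ m + #|A| * #|B| * #|F| ^ (n * m))%N.
Proof.
set Z := (#|F| ^ (n * m))%N; set Q2 := (#|F| ^ (2 * m))%N.
have pairE P P' : ((\sum_(M : 'M_(n, m)) (P \in kpts M) * (P' \in kpts M)) * Q2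
    + (P' == P) * Z = (P' == P) * (Z * #|F| ^ m) + Z)%N.
  case: (eqVneq P P') => [->|PP'] /=; last first.
    by rewrite addn0 add0n sum_in_kpts2.
  under eq_bigr do rewrite mulnb andbb.
  by rewrite !mul1n /Q2 mul2n -addnn expnD mulnA sum_in_kpts.
have sumE c : (\sum_(P in A) \sum_(P' in B) (P' == P) * c = #|A :&: B| * c)%N.
  rewrite -sum_card_setI big_distrl; apply: eq_bigr => P _ /=.
  rewrite -big_distrl /=; congr muln.
  case: (boolP (P \in B)) => PB; first rewrite (bigD1 P) //= eqxx big1 // => P'.
    by move=> /andP[_ /negPf->].
  by rewrite big1 // => P' PB'; case: eqP PB' PB => // -> ->.
transitivity (\sum_(P in A) \sum_(P' in B)
   ((P' == P) * (Z * #|F| ^ m) + Z))%N; last first.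
  under eq_bigr do rewrite big_split /=.
  by rewrite big_split sumE /= !sum_nat_const !mulnA.
under [RHS]eq_bigr do under eq_bigr do rewrite -pairE.
under [RHS]eq_bigr do rewrite big_split /=.
rewrite big_split sumE /=; congr addn.
under [RHS]eq_bigr do rewrite -big_distrl /=.
rewrite -big_distrl; congr muln.
under [RHS]eq_bigr do rewrite exchange_big /=.
rewrite [RHS]exchange_big /=; apply: eq_bigr => M _.
rewrite -!sum_card_setI big_distrl; apply: eq_bigr => P _ /=.
by rewrite -big_distrr.
Qed.

(** * Collisions under projection and the size of a colouring *)

Variables (k : nat) (C : {set {set T}}).

Let q := #|F|.
Local Notation K M := (kpts M).

Hypothesis partC : partition C [set: T].
(** The number of columns is free because matrices with 0, k and k + 1 columns all occur below. *)
Hypothesis monoC : forall l (M : 'M[F]_(n, l)), (\rank M <= k)%N ->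
  exists2 B, B \in C & (1 < #|B :&: K M|)%N.

(** For points outside the kernel of [N], an ordered pair counts once exactly when both have the
    same projection from that kernel: the scalar [c] is then unique and nonzero. *)
Definition collisions (B : {set T}) (N : 'M[F]_(n, k.+1)) : nat :=
  (\sum_(P in B) \sum_(P' in B | P' != P) \sum_(c : F | c != 0%R)
    ((v P - c *: v P') *m N == 0)%R)%N.

Lemma theta_mul_pred m : (q.-1 * theta q m = (q ^ m.+1).-1)%N.
Proof. by rewrite predn_exp. Qed.

Lemma q_gt1 : (1 < q)%N.
Proof. exact: card_finRing_gt1. Qed.

(* The points whose image under [N] spans the line of [u] are the points of the
   kernel of [N *m cokermx u], which has rank at most [k]. *)
Lemma collisions_lb (A : {set T}) (N : 'M[F]_(n, k.+1)) :
    (1 < #|A|)%N ->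
    (forall B, B \in C -> (1 < #|B|)%N -> B :&: K N = set0) -> A \in C ->
  (2 * theta q k <= #|A| + \sum_(B in C | B != A) collisions B N)%N.
Proof.
move=> A1 KN0 AC.
have KN B P : B \in C -> (1 < #|B|)%N -> P \in B -> v P *m N != 0.
  move=> BC B1 PB; apply/negP => vPN.
  by have := KN0 B BC B1; move/setP/(_ P); rewrite !inE PB vPN.
have inK P (u : 'rV_k.+1) : (P \in K (N *m cokermx u)) = (v P *m N <= u)%MS.
  by rewrite inE mulmxA submxE.
(* A colliding pair is seen only by the q - 1 vectors [u] spanning its common image; [a / b] is the
   scalar that [collisions] counts. *)
have pairs B : B \in C ->
  (\sum_(u : 'rV_k.+1 | u != 0%R)
      \sum_(P in B) \sum_(P' in B | P' != P)
        (P \in K (N *m cokermx u)) * (P' \in K (N *m cokermx u))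
   <= q.-1 * collisions B N)%N.
  move=> BC; rewrite exchange_big big_distrr; apply: leq_sum => P PB /=.
  rewrite exchange_big big_distrr; apply: leq_sum => P' /andP[P'B P'P] /=.
  have B1 : (1 < #|B|)%N by apply/card_gt1P; exists P', P.
  have vP0 := KN B P BC B1 PB; have vP'0 := KN B P' BC B1 P'B.
  apply: leq_trans (leq_mul (card_scalar_multiples _ vP0) (leqnn _)).
  rewrite big_distrl; apply: leq_sum => u _ /=; rewrite !inK leq_mul2l.
  case: (boolP (v P *m N <= u)%MS) => //= /sub_rVP[a vPu].
  case: (boolP (v P' *m N <= u)%MS) => //= /sub_rVP[b vP'u].
  have a0 : a != 0 by apply: contraNneq vP0 => a0; rewrite vPu a0 scale0r.
  have b0 : b != 0 by apply: contraNneq vP'0 => b0; rewrite vP'u b0 scale0r.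
  rewrite (bigD1 (a / b)) /=; last by rewrite mulf_neq0 ?invr_eq0.
  by rewrite mulmxBl -scalemxAl vPu vP'u scalerA divfK // subrr eqxx.
(* Each fibre holds a monochromatic pair; a class other than [A] with x >= 2 points there
   contributes x(x - 1) >= 2 ordered pairs. *)
have bin (u : 'rV_k.+1) : u != 0%R ->
  (2 <= #|A :&: K (N *m cokermx u)| + \sum_(B in C | B != A)
     \sum_(P in B) \sum_(P' in B | P' != P)
        (P \in K (N *m cokermx u)) * (P' \in K (N *m cokermx u)))%N.
  move=> u0; have [|B BC B2] := monoC _ (N *m cokermx u).
    by rewrite (leq_trans (mxrankM_maxr _ _)) // mxrank_coker rank_rV u0 subn1.
  have [<-|BA] := eqVneq B A; first exact: leq_trans B2 (leq_addr _ _).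
  rewrite (bigD1 B) ?BC //= sum_distinct_pairs.
  by move: B2; set x := #|_ :&: _|; nia.
(* The (q - 1) theta_k nonzero vectors [u] count every line q - 1 times; this factor cancels at the
   end. *)
have := @leq_sum _ (index_enum _) (fun u : 'rV[F]_k.+1 => u != 0) _ _ bin.
rewrite big_split /= sum_nat_const cardC1 card_mx mul1n -theta_mul_pred.
have leA : (\sum_(u : 'rV_k.+1 | u != 0%R) #|A :&: K (N *m cokermx u)|
   <= q.-1 * #|A|)%N.
  under eq_bigr do rewrite -sum_card_setI.
  rewrite exchange_big mulnC -sum_nat_const; apply: leq_sum => P PA /=.
  under eq_bigr do rewrite inK.
  exact: card_scalar_multiples (KN A P AC A1 PA).
rewrite exchange_big /= => le_sum.
have q1 : (0 < q.-1)%N by have := q_gt1; lia.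
rewrite -(leq_pmul2l q1) mulnDr mulnCA mulnC; apply: leq_trans le_sum _.
rewrite leq_add // big_distrr leq_sum // => B /andP[BC _]; exact: pairs.
Qed.

(** For distinct points [v P - c *: v P'] is nonzero, hence killed by a fraction q^-(k+1) of the
    matrices. *)
Lemma sum_collisions (B : {set T}) :
  ((\sum_N collisions B N) * q ^ k.+1
     = #|B| * #|B|.-1 * q.-1 * q ^ (n * k.+1))%N.
Proof.
rewrite exchange_big big_distrl /= -!mulnA -sum_nat_const.
apply: eq_bigr => P PB; rewrite exchange_big big_distrl /=.
rewrite (cardsD1 P B) PB /= -sum_nat_const.
rewrite [RHS](eq_bigl (fun P' => (P' \in B) && (P' != P))); last first.
  by move=> P'; rewrite !inE andbC.
apply: eq_bigr => P' /andP[_ P'P]; rewrite exchange_big big_distrl /=.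
rewrite -(cardC1 (0 : F)) -sum_nat_const.
apply: eq_big => [c|c _]; first by rewrite inE.
have PP' : P != P' by rewrite eq_sym.
have subf := row_free_row (row_free2_subZ P P' c PP').
by have := sum_mulmx_eq0 k.+1 subf; rewrite mul1n.
Qed.

(** Let b be the sum of [#|B|.-1] over the classes other than [A]. If the kernel of [N] misses all
    non-singleton classes, [collisions_lb] forces b + 1 collisions. Any other [N] is charged b + 1
    per point hit, so the bound holds for every [N] and can be averaged without conditioning. *)
Lemma collisions_average (A : {set T}) : A \in C -> (1 < #|A|)%N ->
    (#|A|.-1 + \sum_(B in C | B != A) #|B|.-1 + 2 <= 2 * theta q k)%N ->
  ((\sum_(B in C | B != A) #|B|.-1).+1 * q ^ k.+1
     <= q.-1 * (\sum_(B in C | B != A) #|B| * #|B|.-1)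
        + (\sum_(B in C | B != A) #|B|.-1).+1
            * (\sum_(B in C | 1 < #|B|) #|B|))%N.
Proof.
move=> AC A1; set b := (\sum_(B in C | _) #|B|.-1)%N => smallC.
have ptw (N : 'M[F]_(n, k.+1)) :
  (b.+1 <= \sum_(B in C | B != A) collisions B N
           + b.+1 * \sum_(B in C | 1 < #|B|) #|B :&: K N|)%N.
  have [/eqP|] := posnP (\sum_(B in C | 1 < #|B|) #|B :&: K N|)%N; last first.
    by move=> z; apply: leq_trans (leq_addl _ _); rewrite leq_pmulr.
  rewrite sum_nat_eq0 => /forall_inP /= z0.
  have KN0 B : B \in C -> (1 < #|B|)%N -> B :&: K N = set0.
    by move=> BC B1; apply/eqP; rewrite -cards_eq0 z0 ?BC.
  apply: leq_trans (leq_addr _ _).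
  have := collisions_lb A N A1 KN0 AC; move: smallC A1.
  set c := (\sum_(B in C | _) collisions B N)%N; set a := #|A|.
  by clearbody a b c; lia.
have Z0 : (0 < q ^ (n * k.+1))%N by rewrite expn_gt0; have := q_gt1; lia.
have /(leq_mul (leqnn (q ^ k.+1))) :=
  @leq_sum _ (index_enum _) xpredT _ _ (fun N _ => ptw N).
rewrite sum_nat_const card_mx -/q big_split /= mulnDr => le_sum.
move: le_sum.
rewrite -big_distrr /=.
rewrite exchange_big /= [X in (_ <= _ + _ * (_ * X))%N -> _]exchange_big /=.
rewrite [(q ^ k.+1 * (b.+1 * _))%N]mulnCA 2!big_distrr /=.
under [X in (_ <= X + _)%N -> _]eq_bigr do rewrite mulnC sum_collisions.
under [X in (_ <= _ + _ * X)%N -> _]eq_bigr do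
  rewrite mulnC (sum_card_kpts).
rewrite -!big_distrl /= -/q => le_sum.
rewrite -(leq_pmul2r Z0) mulnDl -mulnA mulnC -mulnA (leq_trans le_sum) //.
by rewrite [X in (X * _)%N]mulnC mulnA.
Qed.

Lemma two_class_average (A B : {set T}) : A \in C -> B \in C -> A != B ->
  (10 * (q ^ k) ^ 2 + 2 * (#|A| * #|B|) + #|A| + #|B|
     <= 4 * (#|A| + #|B|) * q ^ k + #|A| ^ 2 + #|B| ^ 2
        + 5 * \sum_(D in C | (D != A) && (D != B)) #|D| * #|D|.-1)%N.
Proof.
move=> AC BC AB; set Q := (q ^ k)%N; pose Z := (q ^ (n * k))%N.
have AB0 : A :&: B = set0.
  apply/eqP; rewrite setI_eq0.
  by have /trivIsetP := partition_trivIset partC; apply.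
have Z0 : (0 < Z)%N by rewrite expn_gt0; have := q_gt1; lia.
(* The kernel holds a monochromatic pair of [A], of [B], or of a third class; the terms weighted by
   5 serve the last case. *)
have ptw (M : 'M[F]_(n, k)) :
  (10 + 2 * (#|A :&: K M| * #|B :&: K M|)
      + 5 * \sum_(D in C | (D != A) && (D != B)) #|D :&: K M|
    <= 3 * (#|A :&: K M| + #|B :&: K M|)
     + (#|A :&: K M| * #|A :&: K M| + #|B :&: K M| * #|B :&: K M|)
     + 5 * \sum_(D in C | (D != A) && (D != B)) #|D :&: K M| * #|D :&: K M|)%N.
  have [E EC E2] := monoC _ M (rank_leq_col M).
  have leD (P : pred {set T}) : (\sum_(D | P D) #|D :&: K M|
      <= \sum_(D | P D) #|D :&: K M| * #|D :&: K M|)%N.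
    by apply: leq_sum => D _; case: #|_| => // x; rewrite leq_pmulr.
  have [<-|EA] := eqVneq E A; last have [<-|EB] := eqVneq E B.
  - by rewrite leq_add ?two_class_quadratic ?leq_mul2l ?E2 ?leD.
  - by rewrite leq_add ?two_class_quadratic ?leq_mul2l ?E2 ?orbT ?leD.
  rewrite !(bigD1 (P := fun D => (D \in C) && _) E) /= ?EC ?EA //.
  exact: third_class_quadratic (leD _).
have /(leq_mul (leqnn (Q * Q))) :=
  @leq_sum _ (index_enum _) xpredT _ _ (fun M _ => ptw M).
rewrite !big_split /= !big1_eq sum_nat_const card_mx -/q -/Z !addn0 => le_sum.
have mom1 X := sum_card_kpts k X.
have Q2E : (q ^ (2 * k) = Q ^ 2)%N by rewrite mulnC expnM.
have mom2 X : ((\sum_(M : 'M_(n, k)) #|X :&: K M| * #|X :&: K M|) * Q ^ 2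
    + #|X| * Z = #|X| * Z * Q + #|X| * #|X| * Z)%N.
  by have := sum_card_kpts2 k X X; rewrite setIid -Q2E.
have momAB := sum_card_kpts2 k A B.
rewrite AB0 cards0 -/q -/Z Q2E !mul0n !addn0 in momAB.
pose othersum f := (\sum_(D in C | (D != A) && (D != B)) f D)%N.
have momD : ((\sum_(M : 'M[F]_(n, k)) othersum (fun D => #|D :&: K M|)) * Q
    = othersum (fun D => #|D|) * Z)%N.
  rewrite exchange_big !big_distrl /=; apply: eq_bigr => D _; exact: mom1.
have momDD : ((\sum_(M : 'M[F]_(n, k))
      othersum (fun D => #|D :&: K M| * #|D :&: K M|)) * Q ^ 2
      + othersum (fun D => #|D|) * Z
    = othersum (fun D => #|D|) * Z * Q + othersum (fun D => #|D| * #|D|) * Z)%N.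
  rewrite exchange_big !big_distrl -!big_split /=; apply: eq_bigr => D _.
  exact: mom2.
have predD : (othersum (fun D => #|D| * #|D|.-1) + othersum (fun D => #|D|)
    = othersum (fun D => #|D| * #|D|))%N.
  rewrite -big_split; apply: eq_bigr => D _ /=.
  by case: #|D| => // x; rewrite -mulnSr.
apply: (average_arith Z Q _ _ _ _ _ _ _ _ _ _ _ _ Z0 (mom1 A) (mom1 B) momAB
  (mom2 A) (mom2 B) momD momDD predD).
by rewrite !mulSn !mul0n !addn0.
Qed.

Lemma colouring_excess : (13 <= q)%N -> (0 < k)%N ->
  (2 * theta q k <= (\sum_(B in C) #|B|.-1).+1)%N.
Proof.
move=> q13 k0; rewrite leqNgt; apply/negP => smallC.
have q1 : (0 < q.-1)%N by lia.
have qQ : ((q.-1 * theta q k).+1 = q * q ^ k)%N.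
  by rewrite theta_mul_pred prednK ?expnS // -expnS expn_gt0; lia.
have [B0 B0C B01] : exists2 B, B \in C & (1 < #|B|)%N.
  (* The kernel of a matrix without columns is the whole space. *)
  have [|B BC] := monoC _ (0 : 'M_(n, 0)); first by rewrite mxrank0.
  by move=> /leq_trans/(_ (subset_leq_card (subsetIl _ _))); exists B.
pose A := [arg max_(X > B0 in C) #|X|].
have [AC maxA] : A \in C /\ forall X, X \in C -> (#|X| <= #|A|)%N.
  by rewrite /A; case: arg_maxnP.
have A1 : (1 < #|A|)%N by rewrite (leq_trans B01) // maxA.
set b := (\sum_(B in C | B != A) #|B|.-1)%N.
have sumA : (\sum_(B in C) #|B|.-1 = #|A|.-1 + b)%N by rewrite (bigD1 A).
set t := (\sum_(B in C | (1 < #|B|)%N) #|B|)%N.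
have t_le : (t <= 2 * \sum_(B in C) #|B|.-1)%N.
  rewrite /t big_distrr /= big_mkcondr leq_sum // => X _.
  case: ifP => //; case: #|X| => // x x1.
  by rewrite mul2n -addnn -add1n leq_add.
have avg : (b.+1 * q ^ k.+1
    <= q.-1 * (\sum_(B in C | B != A) #|B| * #|B|.-1) + b.+1 * t)%N.
  by apply: collisions_average => //; move: smallC; rewrite sumA -/b; lia.
have t4 : (t + 4 <= 4 * theta q k)%N by move: t_le smallC; clear; lia.
(* If all other classes are singletons, the average reads q Q <= t <= 4 th - 4, against q Q = (q -
   1) th + 1. *)
have [b0|bpos] := posnP b.
  move: avg; rewrite b0 mul1n mul1n big1 ?muln0 ?add0n => [|X /andP[XC XA]].
    rewrite expnS -qQ => lt_t.
    have := leq_mul (_ : 12 <= q.-1)%N (leqnn (theta q k)).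
    by move: lt_t t4 q13; clear; lia.
  have : (#|X|.-1 <= b)%N by rewrite /b (bigD1 X) ?XC //= leq_addr.
  by rewrite b0 leqn0 => /eqP->; rewrite muln0.
have [B1 B1C B1A] : exists2 B, B \in C & B != A.
  move: bpos; rewrite lt0n sum_nat_eq0 negb_forall => /existsP[X].
  by rewrite negb_imply => /andP[/andP[]]; exists X.
pose B := [arg max_(X > B1 | (X \in C) && (X != A)) #|X|].
have [BC BA maxB] : [/\ B \in C, B != A &
    forall X, X \in C -> X != A -> (#|X| <= #|B|)%N].
  rewrite /B; case: arg_maxnP => [|X /andP[XC XA] maxX]; first exact/andP.
  by split=> // Y YC YA; apply: maxX; rewrite YC.
set R := (\sum_(D in C | (D != A) && (D != B)) #|D|.-1)%N.
have bE : b = (#|B|.-1 + R)%N.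
  rewrite /b (bigD1 B) ?BC //=; congr addn.
  by apply: eq_bigl => D; rewrite andbA.
(* Bounding the other sizes by [#|B|] makes the collision sum at most b [#|B|], and b + 1
   cancels. *)
have B_big : (q * q ^ k <= q.-1 * #|B| + t)%N.
  rewrite -(leq_pmul2l (ltn0Sn b)) -expnS (leq_trans avg) // mulnDr leq_add2r.
  rewrite mulnCA leq_mul2l (leq_trans (n := b * #|B|)) ?orbT ?leq_mul //.
  rewrite big_distrl leq_sum //= => X /andP[XC XA].
  by rewrite mulnC leq_mul2l maxB ?orbT.
have rest : (\sum_(D in C | (D != A) && (D != B)) #|D| * #|D|.-1 <= R.+1 * R)%N.
  rewrite [leqRHS]big_distrr leq_sum //= => X XC.
  have leR : (#|X|.-1 <= R)%N by rewrite /R (bigD1 X) //= leq_addr.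
  by rewrite leq_mul2r (leq_trans (leqSpred _)) ?orbT.
have Qq : (q <= q ^ k)%N by rewrite -[leqLHS]expn1 leq_exp2l // q_gt1.
have sizes : (#|A| + #|B| + R <= 2 * theta q k)%N.
  by move: smallC A1; rewrite sumA bE; clear; case: #|B|; lia.
apply: (no_two_big_classes q13 Qq qQ (maxA _ BC) sizes t4 B_big rest).
by apply: two_class_average; rewrite // eq_sym.
Qed.

End Colouring.

(** * Subspaces of prescribed dimension *)

Lemma exists_subspace {K : fieldType} {vT : vectType K} d (U : {vspace vT}) :
  (d <= \dim U)%N -> exists2 W : {vspace vT}, (W <= U)%VS & \dim W = d.
Proof.
move=> dU; have freeU := basis_free (vbasisP U).
have sz : size (take d (vbasis U)) = d by rewrite size_take_min size_tuple; lia.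
exists <<take d (vbasis U)>>%VS.
  rewrite -[U in (_ <= U)%VS](span_basis (vbasisP U)) sub_span // => x.
  exact: mem_take.
have : free (take d (vbasis U)).
  by move: freeU; rewrite -{1}(cat_take_drop d (vbasis U)) => /catl_free.
by rewrite /free sz => /eqP.
Qed.

(** This passes from matrices to hyperedges: the kernel has dimension at least n - k, and n - k rows
    of a basis of it span [W]. *)
Lemma exists_mulmx_kernel {F : finFieldType} {n k l : nat} (M : 'M[F]_(n, l)) :
  (\rank M <= k)%N -> exists2 W : {vspace 'rV[F]_n},
    \dim W = (n - k)%N & forall w, w \in W -> w *m M = 0.
Proof.
move=> Mk; have dk : (n - k <= \rank (kermx M))%N by rewrite mxrank_ker; lia.
pose R := pid_mx (n - k) *m row_base (kermx M) : 'M_(n - k, n).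
have RM : R *m M = 0.
  by apply/sub_kermxP; rewrite (submx_trans (submxMl _ _)) // eq_row_base.
have freeR : row_free R.
  by rewrite /row_free mxrankMfree ?row_base_free // rank_pid_mx.
pose f := linfun (mulmxr R) : 'Hom('rV_(n - k), 'rV_n).
exists (limg f) => [|w /memv_imgP[u _ ->]]; last first.
  by rewrite lfunE /= -mulmxA RM mulmx0.
rewrite limg_dim_eq ?dimvf ?dim_matrix ?mul1r //.
apply/eqP; rewrite -subv0; apply/subvP => u; rewrite memv_cap memvf memv_ker.
rewrite lfunE /= => /eqP uR; rewrite memv0.
by apply/eqP/(row_free_inj freeR); rewrite uR mul0mx.
Qed.

(** * Points, transversals and colourings of PG(n, q) *)

Section Points.
Variables (F : finFieldType) (n : nat).
Local Notation pt := (pg_point F n).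
Local Notation q := #|F|.

Definition rep (P : pt) : 'rV[F]_n.+1 := vpick (val P).

Lemma rep_neq0 P : rep P != 0.
Proof.
by rewrite vpick0 -dimv_eq0; have /eqP-> := valP P.
Qed.

Lemma val_rep (P : pt) : val P = <[rep P]>%VS.
Proof.
apply/esym/eqP; rewrite eqEdim -memvE memv_pick dim_vline rep_neq0.
by have /eqP-> := valP P.
Qed.

Lemma in_pg_points (P : pt) (W : {vspace 'rV[F]_n.+1}) :
  (P \in pg_points_of W) = (rep P \in W).
Proof. by rewrite inE val_rep memvE. Qed.

Lemma row_free_rep (P P' : pt) :
  P != P' -> row_free (col_mx (rep P) (rep P')).
Proof.
move=> PP'; apply: inj_row_free => c.
rewrite -[c]hsubmxK mul_row_col; set a := lsubmx c; set b := rsubmx c.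
rewrite [a]mx11_scalar [b]mx11_scalar !mul_scalar_mx => e.
have b0 : b 0 0 = 0.
  apply: contraNeq PP' => b0; apply/eqP/val_inj; rewrite /= !val_rep.
  apply/esym/eqP; rewrite eqEdim !dim_vline !rep_neq0 andbT -memvE.
  move/eqP: e; rewrite addrC addr_eq0 => /eqP e.
  apply/vlineP; exists (- (b 0 0)^-1 * a 0 0).
  by rewrite mulNr scaleNr -scalerA -scalerN -e scalerA mulVf // scale1r.
have a0 : a 0 0 = 0.
  move: e; rewrite b0 scale0r addr0 => /eqP; rewrite scaler_eq0.
  by rewrite (negPf (rep_neq0 P)) orbF => /eqP.
by rewrite a0 b0 !raddf0 row_mx0.
Qed.

Lemma card_vspace_neq0 (W : {vspace 'rV[F]_n.+1}) :
  #|[set u | (u != 0) && (u \in W)]| = (q ^ \dim W).-1.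
Proof.
rewrite -card_vspace [#|W|](cardD1 0) mem0v /=; apply: eq_card => u.
by rewrite !inE.
Qed.

(** Each point is spanned by exactly q - 1 nonzero vectors, so the nonzero vectors of [W] are
    counted by fibres of [p]. *)
Lemma card_pg_points (W : {vspace 'rV[F]_n.+1}) :
  (q.-1 * #|pg_points_of W| = (q ^ \dim W).-1)%N.
Proof.
(* A default for [insubd], taken only at the zero vector. *)
have P0 : pt.
  pose u : 'rV[F]_n.+1 := const_mx 1.
  have u0 : u != 0.
    by apply/eqP => /matrixP/(_ 0 0)/eqP; rewrite !mxE oner_eq0.
  by exists <[u]>%VS; rewrite dim_vline u0.
pose p (u : 'rV[F]_n.+1) : pt := insubd P0 <[u]>%VS.
have val_p u : u != 0 -> val (p u) = <[u]>%VS.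
  by move=> u0; rewrite insubdK // -topredE /= dim_vline u0.
rewrite -card_vspace_neq0 -[RHS]sum1_card.
rewrite (partition_big p (mem (pg_points_of W))) /=; last first.
  by move=> u; rewrite !inE => /andP[u0 uW]; rewrite val_p // -memvE.
rewrite mulnC -sum_nat_const; apply: eq_bigr => P; rewrite inE => PW.
have /eqP dimP := valP P.
have -> : q.-1 = (q ^ \dim (val P)).-1 by rewrite dimP expn1.
rewrite sum1dep_card -card_vspace_neq0.
apply: eq_card => u; rewrite !inE; case: (boolP (u == 0)) => //= u0.
rewrite -val_eqE /= val_p //; apply/idP/andP => [uP|[uW /eqP <-]].
  split; first by rewrite memvE (subv_trans _ PW) // -memvE.
  by rewrite eqEdim -memvE uP dim_vline u0 dimP.
exact: memv_line.
Qed.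

Lemma card_pg_points_theta d (W : {vspace 'rV[F]_n.+1}) :
  \dim W = d.+1 -> #|pg_points_of W| = theta q d.
Proof.
move=> dimW; have q1 : (0 < q.-1)%N by rewrite -subn1 subn_gt0 card_finRing_gt1.
by apply/eqP; rewrite -(eqn_pmul2l q1) card_pg_points dimW predn_exp.
Qed.

Lemma card_pg_point : #|pt| = theta q n.
Proof.
rewrite -(card_pg_points_theta n fullv) ?dimvf ?dim_matrix ?mul1r //.
by apply: eq_card => P; rewrite !inE subvf.
Qed.

(** Two disjoint k-dimensional subspaces fit because 2(k + 1) <= n + 1, and each meets every
    hyperedge because (k + 1) + (n - k + 1) exceeds n + 1. *)
Lemma exists_2transversal k : (2 * k < n)%N ->
  exists2 X : {set vertex (pg_hypergraph F n (n - k))},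
    t_transversal 2 X & #|X| = (2 * theta q k)%N.
Proof.
move=> kn; have dimT : \dim {:'rV[F]_n.+1} = n.+1.
  by rewrite dimvf dim_matrix mul1r.
have [|U _ dimU] := exists_subspace k.+1 {:'rV[F]_n.+1}.
  by rewrite dimT; lia.
have [|V VU dimV] := exists_subspace k.+1 (U^C)%VS.
  by rewrite dimv_compl dimT dimU; lia.
have UV0 P : P \in pg_points_of U -> P \in pg_points_of V -> False.
  rewrite !in_pg_points => PU PV; apply/negP: (rep_neq0 P).
  by rewrite negbK -memv0 -(capv_compl U) memv_cap PU (subvP VU).
have meet (U' W : {vspace 'rV[F]_n.+1}) : \dim U' = k.+1 ->
    \dim W = (n - k).+1 ->
    exists P : pt, P \in pg_points_of U' :&: pg_points_of W.
  move=> dimU' dimW; have := dimv_sum_cap U' W.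
  have := dimvS (subvf (U' + W)); rewrite dimT.
  rewrite dimU' dimW => le_n sumE.
  have [|L LUW dimL] := exists_subspace 1 (U' :&: W)%VS; first by lia.
  exists (exist _ L (introT eqP dimL)); rewrite !inE /=.
  by move: LUW; rewrite subv_cap.
exists (pg_points_of U :|: pg_points_of V); last first.
  rewrite cardsU !(card_pg_points_theta k) //.
  rewrite (_ : _ :&: _ = set0) ?cards0 ?subn0 ?addnn ?mul2n //.
  apply/setP => P; rewrite !inE; apply/negP => /andP[].
  by have := UV0 P; rewrite !inE.
apply/forall_inP => _ /imsetP[W + ->]; rewrite inE => /eqP dimW.
have [P /setIP[PU PW]] := meet U W dimU dimW.
have [P' /setIP[PV' PW']] := meet V W dimV dimW.
apply/card_gt1P; exists P, P'; split.
- by rewrite inE PW inE PU.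
- by rewrite inE PW' inE PV' orbT.
- by apply/eqP => PP'; apply: (UV0 P) => //; rewrite PP'.
Qed.

Lemma colorable_theta N k : (0 < k)%N -> (k <= n)%N -> (13 <= q)%N ->
  colorable (pg_hypergraph F n (n - k)) N ->
  (N + 2 * theta q k <= (theta q n).+1)%N.
Proof.
move=> k0 kn q13 /existsP[C /andP[/andP[partC /eqP cardC]] /forall_inP freeC].
have monoC l (M : 'M[F]_(n.+1, l)) : (\rank M <= k)%N ->
    exists2 B, B \in C & (1 < #|B :&: kpts F pt n.+1 rep M|)%N.
  move=> /exists_mulmx_kernel[W dimW WM].
  have /freeC : pg_points_of W \in edges (pg_hypergraph F n (n - k)).
    by apply/imsetP; exists W => //; rewrite inE dimW subSn.
  case/forall_inPn => P PW /forall_inPn[P' P'W].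
  rewrite negb_imply negbK => /andP[PP' /eqP eqC].
  have covC X : X \in cover C by rewrite (cover_partition partC).
  exists (pblock C P); first by rewrite pblock_mem.
  apply/card_gt1P; exists P, P'; split=> //.
    by rewrite !inE mem_pblock covC; apply/eqP/WM; rewrite -in_pg_points.
  by rewrite !inE eqC mem_pblock covC; apply/eqP/WM; rewrite -in_pg_points.
have := colouring_excess F pt n.+1 rep rep_neq0 row_free_rep k C partC monoC
  q13 k0.
(* The class sizes add up to theta_n, so the excess bounded by [colouring_excess] is theta_n - N. *)
have : (\sum_(B in C) #|B|.-1 + N = theta q n)%N.
  rewrite -card_pg_point -cardsT (card_partition partC) -cardC -sum1_card.
  rewrite -big_split; apply: eq_bigr => B BC /=.
  rewrite addn1 prednK // card_gt0.
  by have /and3P[_ _] := partC; apply: contraNneq => <-.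
by move: (\sum_(B in C) _)%N => x; lia.
Qed.
End Points.

(** * Transversals as colourings, and the two values *)

Lemma transversal_colorable (H : hypergraph) (X : {set vertex H}) :
  (0 < #|X|)%N -> t_transversal 2 X -> colorable H (#|vertex H| - #|X|).+1.
Proof.
move=> X0 /forall_inP trX; pose C := X |: [set [set x] | x in ~: X].
have XC : X \in C by rewrite setU11.
have disj : trivIset C.
  apply/trivIsetP => A B.
  move=> /setU1P[->|/imsetP[x xX ->]] /setU1P[->|/imsetP[y yX ->]].
  - by rewrite eqxx.
  - by rewrite disjoint_sym disjoints1 -in_setC yX.
  - by rewrite disjoints1 -in_setC xX.
  - by move=> xy; rewrite disjoints1 inE; apply: contraNneq xy => ->.
apply/existsP; exists C; apply/andP; split; last first.
  apply/forall_inP => e /trX /card_gt1P[x [y [/setIP[xX xe] /setIP[yX ye] xy]]].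
  apply/forall_inPn; exists x => //; apply/forall_inPn; exists y => //.
  by rewrite xy negbK !(def_pblock disj XC).
apply/andP; split.
  apply/and3P; split=> //.
    apply/eqP/setP => x; rewrite inE; apply/bigcupP.
    have [xX|xX] := boolP (x \in X); first by exists X.
    by exists [set x]; rewrite ?set11 // setU1r // imset_f // inE.
  apply/setU1P => -[X_0|/imsetP[x _ /setP/(_ x)]].
    by rewrite -X_0 cards0 in X0.
  by rewrite !inE eqxx.
rewrite cardsU1 card_imset; last exact: set1_inj.
rewrite cardsCs setCK (_ : X \notin _) ?add1n //.
apply/imsetP => -[x + XE]; rewrite inE => /negP; apply.
by rewrite XE set11.
Qed.

Theorem theorem1p6 (F : finFieldType) (q n k : nat)
    (hq : #|F| = q)
    (hn : (3 <= n)%N)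
    (hk1 : (1 <= k)%N)
    (hkn : (2 * k < n)%N)
    (hq1 : k = 1%N -> (17 <= q)%N)
    (hq2 : (2 <= k)%N -> (13 <= q)%N) :
  (upper_chromatic (pg_hypergraph F n (n - k)))%:Z
    = (theta q n)%:Z - (tau 2 (pg_hypergraph F n (n - k)))%:Z + 1
  /\
  (theta q n)%:Z - (tau 2 (pg_hypergraph F n (n - k)))%:Z + 1
    = (theta q n)%:Z - 2 * (theta q k)%:Z + 1.
Proof.
have q13 : (13 <= q)%N.
  have [/hq2 //|k1] := leqP 2 k; have := hq1 _; lia.
subst q; set H := pg_hypergraph F n (n - k); have kn : (k <= n)%N by lia.
have th0 : (0 < theta #|F| k)%N by rewrite /theta big_ord_recl.
have cardH : #|vertex H| = theta #|F| n by exact: card_pg_point.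
have [X0 trX0 cardX0] := exists_2transversal F n k hkn.
(* Ensures that the truncated subtraction in [chiH] agrees with the integer one. *)
have X0_le : (2 * theta #|F| k <= theta #|F| n)%N.
  by rewrite -cardX0 -cardH max_card.
have colH N : colorable H N -> (N + 2 * theta #|F| k <= (theta #|F| n).+1)%N.
  exact: colorable_theta.
have edgeH : exists e, e \in edges H.
  have [|W _ dimW] := exists_subspace (n - k).+1 {:'rV[F]_n.+1}.
    by rewrite dimvf dim_matrix mul1r; lia.
  by exists (pg_points_of W); apply/imsetP; exists W; rewrite ?inE ?dimW.
(* The colouring built from any 2-transversal [X] has theta_n - |X| + 1 colours, so [colH] gives |X|
   >= 2 theta_k. *)
have tauH : tau 2 H = (2 * theta #|F| k)%N.
  apply/tauP; first by exists X0.
  split=> [|X trX]; first by exists X0.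
  have X_gt0 : (0 < #|X|)%N.
    have [e /(forall_inP trX) ge2] := edgeH.
    by rewrite (leq_trans _ (subset_leq_card (subsetIl X e))) // ltnW.
  have := colH _ (transversal_colorable H X X_gt0 trX).
  have : (#|X| <= #|vertex H|)%N by exact: max_card.
  by rewrite cardH; lia.
have colX0 := transversal_colorable H X0 _ trX0.
have chiH : upper_chromatic H = (theta #|F| n - 2 * theta #|F| k).+1.
  apply/upper_chromaticP.
    by exists (#|vertex H| - #|X0|).+1; apply: colX0; rewrite cardX0; lia.
  split=> [|N /colH]; last by lia.
  by rewrite -cardX0 -cardH; apply: colX0; rewrite cardX0; lia.
by rewrite tauH chiH; split; lia.
Qed.
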